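(* There exist an automorphism $T$ of a measurable space $(X,\mathcal F)$, a countable measurable partition $\xi$ of $X$, a $T$-invariant probability measure $\mu$, a sequence of $T$-invariant probability measures $\mu_n$ ($n\ge1$), and sequences of numbers $r_n\in\mathbb N$, $\varepsilon_n>0$ such that (i) $\lim_{n\to\infty} r_n=\infty$ and $\lim_{n\to\infty}\varepsilon_n=0$; (ii) $|\mu(A)-\mu_n(A)|\le \varepsilon_n\mu_n(A)$ for all $n\ge 1$ and all atoms $A$ of the partition $\bigvee_{i=0}^{r_n}T^{-i}\xi$; (iii) $\xi$ is a generator for $(T,\mu)$ and for $(T,\mu_n)$, for every $n\ge 1$; but the inequality $h_\mu(T)\ge\limsup_{n\to\infty}h_{\mu_n}(T)$ fails, i.e. $$h_\mu(T)<\limsup_{n\to\infty}h_{\mu_n}(T).$$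
   Context: An automorphism $T$ of a measurable space $(X,\mathcal F)$ is an invertible map $X\to X$ that is measurable together with its inverse. All measures are defined on $\mathcal F$. $h_\mu(T)$ denotes the Kolmogorov--Sinai entropy of $T$ with respect to the $T$-invariant probability measure $\mu$ (possibly $+\infty$). $\bigvee$ denotes the common refinement (join) of partitions. A countable measurable partition $\eta$ is called a generator (generating partition) for $(T,\mu)$ if the $\sigma$-algebra generated by the partitions $T^i\eta$, $i\in\mathbb Z$, coincides with $\mathcal F$ modulo $\mu$-null sets. (No finiteness of the entropy $H_\mu(\xi)$ of the partition $\xi$ is required here.) *)

(* Defs.v *)
From mathcomp Require Import all_boot all_order all_algebra.
From mathcomp Require Import all_classical all_reals all_analysis.
Set Implicit Arguments.
Unset Strict Implicit.
Unset Printing Implicit Defensive.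
Import Order.TTheory GRing.Theory Num.Theory.
Local Open Scope classical_set_scope.
Local Open Scope ring_scope.

Definition measurable_automorphism d (X : measurableType d) (T : X -> X) : Prop :=
  exists S : X -> X,
    [/\ cancel T S, cancel S T, measurable_fun setT T & measurable_fun setT S].

Definition invariant_measure d (X : measurableType d) (R : realType) (T : X -> X)
    (mu : probability X R) : Prop :=
  forall A : set X, measurable A -> mu (T @^-1` A) = mu A.

(* A partition is the set of its atoms; [classical_sets.partition] requires
   the atoms to be nonempty. *)
Definition measurable_partition d (X : measurableType d)
    (P : set (set X)) : Prop :=
  classical_sets.partition P id [set: X] /\ P `<=` measurable.

(* P_0 \/ ... \/ P_(n-1), with atoms the nonempty intersections
   A_0 `&` ... `&` A_(n-1) where each A_i is an atom of P_i. *)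
Definition partition_join X (P : nat -> set (set X)) (n : nat) : set (set X) :=
  [set B | B !=set0 /\
    exists2 A : nat -> set X,
      (forall i, (i < n)%N -> P i (A i)) & B = \bigcap_(i < n) A i].

(* The atoms of T^i P for an invertible T: direct images for i >= 0,
   preimages for i < 0. *)
Definition partition_shift X (T : X -> X) (i : int) (P : set (set X)) :
    set (set X) :=
  match i with
  | Posz n => [set iter n T @` A | A in P]
  | Negz n => [set iter n.+1 T @^-1` A | A in P]
  end.

(* The join of the T^-i P for 0 <= i < n. *)
Definition dynamical_join X (T : X -> X) (P : set (set X)) (n : nat) :
    set (set X) :=
  partition_join (fun i => partition_shift T (- i%:Z) P) n.

Definition eq_mod_null d (X : measurableType d) (R : realType)
    (mu : probability X R) (F G : set (set X)) : Prop :=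
  (forall A, F A -> exists2 B, G B & mu (A `+` B) = 0%E) /\
  (forall B, G B -> exists2 A, F A & mu (A `+` B) = 0%E).

Definition partition_generator d (X : measurableType d) (R : realType) (T : X -> X)
    (mu : probability X R) (P : set (set X)) : Prop :=
  [/\ measurable_partition P, countable P &
      eq_mod_null mu <<s \bigcup_(i in [set: int]) partition_shift T i P >>
        measurable].

(* The convention 0 * ln 0 = 0 holds because ln 0 = 0 in the library. *)
Definition partition_entropy d (X : measurableType d) (R : realType)
    (mu : probability X R) (P : set (set X)) : \bar R :=
  \esum_(A in P) (- (fine (mu A) * ln (fine (mu A))))%:E.

(* For invariant mu and a finite measurable partition P, the limit exists by
   subadditivity. *)
Definition entropy_rate d (X : measurableType d) (R : realType) (T : X -> X)
    (mu : probability X R) (P : set (set X)) : \bar R :=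
  limn (fun n : nat =>
    (n%:R^-1)%:E * partition_entropy mu (dynamical_join T P n))%E.

Definition KS_entropy d (X : measurableType d) (R : realType) (T : X -> X)
    (mu : probability X R) : \bar R :=
  ereal_sup [set entropy_rate T mu P | P in
    [set P | measurable_partition P /\ finite_set P]].

(* Main.v *)
(* Let the level-k component of a system have the alphabet of 2^k-bit words.  The
   measure mu gives it mass 2^-(k+1) and the law of the sequence
   i |-> w_(i mod (k+1)), where w_0, ..., w_k are independent uniform letters; mu_n
   replaces, on level n only, this periodic law by the Bernoulli law
   i |-> w_i.  Both laws have the same marginals on n+1 consecutive letters, so mu
   and mu_n agree exactly on the atoms of the join up to r_n = n.  The measure mu
   is purely atomic, hence has entropy 0, whereas the Bernoulli component
   contributes 2^-(n+1) * ln (2^(2^n)) = (ln 2) / 2 to the entropy of mu_n. *)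

Require Import Defs.
From HB Require Import structures.
From mathcomp Require Import all_boot all_order all_algebra.
From mathcomp Require Import all_classical all_reals all_analysis.
From mathcomp Require Import zify ring lra.
Set Implicit Arguments.
Unset Strict Implicit.
Unset Printing Implicit Defensive.
Import Order.TTheory GRing.Theory Num.Theory.
Local Open Scope classical_set_scope.
Local Open Scope ring_scope.

(** * Fair coins from the binary digits of a uniform variable *)

Definition bit (R : realType) (n : nat) (x : R) : bool :=
  odd (Num.truncn (2 ^+ n.+1 * x)).

(** The integer with binary digits [c 0], ..., [c (m-1)], most significant first: it is the index of
    the dyadic interval of length 2^-m on which the first m bits are those of [c]. *)
Fixpoint bin_prefix (c : nat -> bool) (m : nat) : nat :=
  if m is m'.+1 then ((bin_prefix c m').*2 + c m')%N else 0%N.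

(** Induction on [m]: each further bit selects the left or the right half of the current dyadic
    interval. *)
Lemma bits_prefixP (R : realType) (c : nat -> bool) m (x : R) :
  (0 <= x < 1 /\ forall i, (i < m)%N -> bit i x = c i) <->
  (bin_prefix c m)%:R <= 2 ^+ m * x < (bin_prefix c m).+1%:R.
Proof.
elim: m => [|m IH] /=; first by rewrite expr0 mul1r; split=> [[]|].
have E : 2 ^+ m.+1 * x = 2 * (2 ^+ m * x) by rewrite exprS mulrA.
have -> : (0 <= x < 1 /\ forall i, (i < m.+1)%N -> bit i x = c i) <->
    ((bin_prefix c m)%:R <= 2 ^+ m * x < (bin_prefix c m).+1%:R /\
     bit m x = c m).
  rewrite -IH; split=> [[x01 xc]|[[x01 xc] xm]].
    by split; [split=> // i im; apply: xc; exact: ltnW|exact: xc].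
  by split=> // i; rewrite ltnS leq_eqVlt => /orP[/eqP->//|]; exact: xc.
rewrite /bit E; set y := 2 ^+ m * x; set v := bin_prefix c m.
rewrite -!addnn -(addn1 v) -(addn1 (_ + _ + _)) !natrD.
split=> [[/andP[vy yv] <-]|].
  have y0 : 0 <= 2 * y by rewrite mulr_ge0// (le_trans _ vy).
  have /andP[ty yt] := truncn_itv y0.
  set t := Num.truncn (2 * y) in ty yt *.
  have t1 : (v + v < t.+1)%N by rewrite -(@ltr_nat R) natrD; lra.
  have t2 : (t < v + v + 2)%N by rewrite -(@ltr_nat R) !natrD; lra.
  have -> : (odd t)%:R = t%:R - v%:R - v%:R :> R.
    have -> : t = (v + v + odd t)%N by lia.
    by rewrite !oddD addbb/=; case: (odd t); rewrite /= !natrD; lra.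
  by rewrite -addn1 natrD in yt; lra.
move=> /andP[ly yl].
have c01 : 0 <= ((c m)%:R : R) <= 1 by case: (c m); rewrite /= ?lexx ?ler01.
split; first lra.
rewrite (@truncn_def _ _ (v + v + c m)); last first.
  by rewrite -(addn1 (_ + _)) !natrD; lra.
by rewrite addnn oddD odd_double; case: (c m).
Qed.

Lemma measurable_bit (R : realType) n (b : bool) :
  measurable [set x : R | bit n x = b].
Proof.
wlog -> : b / b = true => [mbit|].
  case: b; first exact: mbit.
  rewrite (_ : mkset _ = ~` [set x : R | bit n x = true]).
    by apply: measurableC; exact: mbit.
  by apply/seteqP; split=> x /=; case: bit.
(* The odd values of the truncation are the [w.+1] with [w] even. They are positive, which excludes
   negative [x], where the truncation is 0. *)
rewrite (_ : mkset _ = \bigcup_(w in [set w | ~~ odd w])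
    `[w.+1%:R / 2 ^+ n.+1, w.+2%:R / 2 ^+ n.+1[%classic).
  by apply: bigcup_measurable => w _; exact: measurable_itv.
have e2 : 0 < 2 ^+ n.+1 :> R by rewrite exprn_gt0.
apply/seteqP; split=> [x /=|x [w /= ow]].
  rewrite /bit => ot.
  case E : (Num.truncn (2 ^+ n.+1 * x)) ot => [//|w] /= ow.
  exists w => //; rewrite /= in_itv/= ler_pdivrMr// ltr_pdivlMr// mulrC.
  by rewrite -truncn_gt_nat -truncn_le_nat E ltnSn.
rewrite in_itv/= ler_pdivrMr// ltr_pdivlMr// mulrC => /truncn_def.
by rewrite /bit => ->.
Qed.

Definition unit_itv {R : realType} : set R := `[0, 1[%classic.

Lemma measurable_unit_itv (R : realType) : measurable (@unit_itv R).
Proof. exact: measurable_itv. Qed.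

Definition uniform01 (R : realType) : set (measurableTypeR R) -> \bar R :=
  mrestr lebesgue_measure (@measurable_unit_itv R).

HB.instance Definition _ (R : realType) := Measure.copy (@uniform01 R)
  (mrestr lebesgue_measure (@measurable_unit_itv R)).

Lemma uniform01_setT (R : realType) : @uniform01 R setT = 1%E.
Proof.
by rewrite /uniform01 /mrestr setTI lebesgue_measure_itv/= lte_fin ltr01 oppr0 adde0.
Qed.

HB.instance Definition _ (R : realType) :=
  Measure_isProbability.Build _ _ _ (@uniform01 R) (uniform01_setT R).

Definition bits_on (R : realType) (s : seq nat) (c : nat -> bool) :
    set (measurableTypeR R) :=
  [set x | {in s, forall i, bit i x = c i}].

Lemma measurable_bits_on (R : realType) s c : measurable (@bits_on R s c).
Proof.
elim: s => [|a s IH].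
  by rewrite (_ : bits_on _ _ = setT)//; apply/seteqP; split.
rewrite (_ : bits_on _ _ = [set x | bit a x = c a] `&` bits_on s c).
  by apply: measurableI => //; exact: measurable_bit.
apply/seteqP; split=> [x xc|x [xa xc] i].
  by split=> [|i si]; apply: xc; rewrite inE ?eqxx ?si ?orbT.
by rewrite inE => /orP[/eqP->//|]; exact: xc.
Qed.

Lemma uniform01_prefix (R : realType) m c :
  uniform01 (@bits_on R (iota 0 m) c) = ((2 ^+ m)^-1)%:E.
Proof.
have e2 : 0 < 2 ^+ m :> R by rewrite exprn_gt0.
rewrite /uniform01 /mrestr (_ : _ `&` _ =
  `[(bin_prefix c m)%:R / 2 ^+ m, (bin_prefix c m).+1%:R / 2 ^+ m[%classic).
  rewrite lebesgue_measure_itv/= lte_fin ltr_pM2r ?invr_gt0// ltr_nat ltnSn.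
  by rewrite -EFinB -mulrBl -natrB// subSnn mul1r.
apply/seteqP; split=> x /=.
  move=> [xc]; rewrite /unit_itv/= !in_itv/= => x01.
  rewrite ler_pdivrMr// ltr_pdivlMr// mulrC; apply/bits_prefixP; split=> // i im.
  by apply: xc; rewrite mem_iota.
rewrite in_itv/= ler_pdivrMr// ltr_pdivlMr// mulrC => /bits_prefixP[x01 xc].
by split; [move=> i; rewrite mem_iota => /= /xc|rewrite /unit_itv/= in_itv].
Qed.

(** Induction on the number of positions below [m] missing from [s]. With none missing, [s] permutes
    a prefix; otherwise a missing bit [j] splits the event into two disjoint events of half the
    claimed mass. *)
Lemma uniform01_bits_on (R : realType) (s : seq nat) c : uniq s ->
  uniform01 (@bits_on R s c) = ((2 ^+ size s)^-1)%:E.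
Proof.
move=> us; pose m := (\max_(i <- s) i).+1.
have sm : {subset s <= iota 0 m}.
  by move=> i si; rewrite mem_iota/= add0n ltnS; exact: leq_bigmax_seq.
move: us sm; move: m => m us sm.
have /subnKC : (size s <= m)%N by rewrite -(size_iota 0 m) uniq_leq_size.
move: (m - size s)%N => d; elim: d s c us sm => [|d IH] s c us sm.
  rewrite addn0 => sE; rewrite sE -(uniform01_prefix _ m c); congr uniform01.
  have [|_ is_] := uniq_min_size us sm; first by rewrite size_iota sE.
  by apply/seteqP; split=> x xc i; [rewrite -is_|rewrite is_]; exact: xc.
move=> sE.
have [j jm js] : exists2 j, (j < m)%N & j \notin s.
  have : ~~ all [in s] (iota 0 m).
    apply/negP => /allP ms; have := uniq_leq_size (iota_uniq 0 m) ms.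
    by rewrite size_iota -sE addnS ltnNge leq_addr.
  by case/allPn => j; rewrite mem_iota => jm js; exists j.
pose cb b i := if i == j then b else c i.
have sj b : uniform01 (@bits_on R (j :: s) (cb b)) = ((2 ^+ (size s).+1)^-1)%:E.
  apply: IH => /=; first by rewrite js.
    by move=> i; rewrite inE => /orP[/eqP->|/sm//]; rewrite mem_iota.
  by rewrite -sE addSnnS.
rewrite (_ : bits_on s c =
  bits_on (j :: s) (cb true) `|` bits_on (j :: s) (cb false)).
  rewrite measureU; try exact: measurable_bits_on.
    rewrite [X in (X + _)%E](sj true) [X in (_ + X)%E](sj false) -EFinD exprS.
    by congr EFin; field; rewrite expf_neq0.
  apply/seteqP; split=> // x [/(_ j) + /(_ j)].
  by rewrite /cb !inE eqxx => /(_ isT) -> /(_ isT).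
apply/seteqP; split=> x /=.
  move=> xc; case E : (bit j x); [left|right] => i; rewrite inE /cb;
    case: eqP => [->//|_]; exact: xc.
by move=> [] xc i si; have := xc i; rewrite inE si orbT /cb => /(_ isT);
  case: eqP => // ij; rewrite -ij si in js.
Qed.

(** Prescribing only the value [true] gives a family closed under intersection, by concatenation of
    lists; complements recover the value [false]. *)
Definition true_cylinders (I : Type) : set (set (I -> bool)) :=
  [set [set w : I -> bool | all w s] | s in [set: seq I]].

Definition coin_space (I : Type) : measurableType (@true_cylinders I).-sigma :=
  g_sigma_algebraType (@true_cylinders I).

Lemma measurable_coin (I : Type) (i : I) (b : bool) :
  measurable [set w : coin_space I | w i = b].
Proof.
have mi : measurable [set w : coin_space I | w i = true].
  apply: sub_sigma_algebra; exists [:: i] => //.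
  by apply/seteqP; split=> w /=; rewrite andbT.
case: b => //; rewrite (_ : mkset _ = ~` [set w : coin_space I | w i = true]).
  exact: measurableC.
by apply/seteqP; split=> w /=; case: (w i).
Qed.

Lemma measurable_to_coin_space d (T : measurableType d) (I : Type)
    (f : T -> coin_space I) :
  (forall i, measurable [set x | f x i = true]) -> measurable_fun setT f.
Proof.
move=> mf; apply: (@measurability _ _ _ (coin_space I) _ _ (@true_cylinders I)) => //.
move=> _ [_ [s _ <-] <-]; rewrite setTI; elim: s => [|i s IH].
  by rewrite (_ : _ @^-1` _ = setT)//; apply/seteqP; split.
rewrite (_ : _ @^-1` _ = [set x | f x i = true] `&` f @^-1` [set w : I -> bool | all w s]).
  exact: measurableI.
by apply/seteqP; split=> x /= => [/andP|] // [-> ->].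
Qed.

Section coin_measure.
Variables (R : realType) (I : countType).

(** Since [pickle] is injective, distinct indices read distinct binary digits, so the coordinates
    are independent fair coins. *)
Definition toss (x : measurableTypeR R) : coin_space I := fun i => bit (pickle i) x.

Lemma measurable_toss : measurable_fun setT toss.
Proof. by apply: measurable_to_coin_space => i; exact: measurable_bit. Qed.

HB.instance Definition _ := isMeasurableFun.Build _ _ _ _ toss measurable_toss.

Definition coin : probability (coin_space I) R := distribution (@uniform01 R) toss.

Lemma coin_word (s : seq I) (c : I -> bool) : uniq s ->
  coin [set w : I -> bool | {in s, forall i, w i = c i}] = ((2 ^+ size s)^-1)%:E.
Proof.
move=> us; pose c' n := if unpickle n is Some i then c i else false.
rewrite -(size_map pickle) -(uniform01_bits_on _ c'); last first.
  by rewrite map_inj_uniq//; exact: (pcan_inj pickleK).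
congr uniform01; apply/seteqP; split=> x /= xc.
  by move=> _ /mapP[i si ->]; rewrite /c' pickleK; exact: xc.
by move=> i si; rewrite /toss (xc (pickle i)) ?map_f// /c' pickleK.
Qed.

Definition reindex (sigma : I -> I) (w : coin_space I) : coin_space I := w \o sigma.

Lemma measurable_reindex sigma : measurable_fun setT (reindex sigma).
Proof. by apply: measurable_to_coin_space => i; exact: measurable_coin. Qed.

HB.instance Definition _ sigma :=
  isMeasurableFun.Build _ _ _ _ (reindex sigma) (measurable_reindex sigma).

(** Both measures agree on [true_cylinders], a pi-system: an injection preserves the number of
    distinct indices in a list, and the mass depends on that number only. *)
Lemma coin_reindex sigma A : injective sigma -> measurable A ->
  coin (reindex sigma @^-1` A) = coin A.
Proof.
move=> sI mA.
have coin_all s : coin [set w : I -> bool | all w s] = ((2 ^+ size (undup s))^-1)%:E.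
  rewrite -(coin_word (fun=> true)) ?undup_uniq//; congr (coin _).
  apply/seteqP; split=> w /=; first by move=> /allP ws i; rewrite mem_undup => /ws.
  by move=> ws; apply/allP => i si; rewrite /= ws// mem_undup.
apply: (@g_sigma_algebra_measure_unique _ R (coin_space I) (@true_cylinders I)
  _ (fun=> setT) _ _ (distribution coin (reindex sigma)) coin) => //.
- exact: sub_sigma_algebra.
- by move=> _; exists [::] => //; apply/seteqP; split.
- by rewrite bigcup_const//; exists 0%N.
- move=> _ _ [s _ <-] [t _ <-]; exists (s ++ t) => //.
  by apply/seteqP; split=> w /=; rewrite all_cat => /andP.
- move=> _ [s _ <-].
  rewrite [RHS]coin_all -(size_map sigma) -undup_map_inj// -coin_all.
  by congr (coin _); apply/seteqP; split=> w; rewrite /= all_map.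
- move=> _; apply: (@le_lt_trans _ _ 1%E); last exact: ltry.
  exact: (@probability_le1 _ _ _ (distribution coin (reindex sigma))).
Qed.

End coin_measure.

(** * The shift space and its generator *)

(** A level together with a two-sided sequence of bit streams; infinite streams let one type host
    the alphabets of all levels. *)
Definition tagged_shift_space : Type := nat * (int -> nat -> bool).
HB.instance Definition _ := Pointed.on tagged_shift_space.

Definition shift_by (z : int) (x : tagged_shift_space) : tagged_shift_space :=
  (x.1, fun i => x.2 (i + z)).

Lemma shift_by0 : shift_by 0 = id.
Proof. by apply/funext => -[k w]; congr pair; apply/funext => i /=; rewrite addr0. Qed.

Lemma shift_byD a b x : shift_by a (shift_by b x) = shift_by (a + b) x.
Proof. by congr pair; apply/funext => i /=; rewrite addrA. Qed.

Lemma shift_byK z : cancel (shift_by z) (shift_by (- z)).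
Proof. by move=> x; rewrite shift_byD addNr shift_by0. Qed.

Lemma shift_byNK z : cancel (shift_by (- z)) (shift_by z).
Proof. by move=> x; rewrite shift_byD addrN shift_by0. Qed.

Lemma iter_shift n : iter n (shift_by 1) = shift_by n%:Z.
Proof.
elim: n => [|n IH]; first by rewrite shift_by0.
by apply/funext => x; rewrite iterS IH shift_byD intS.
Qed.

(* A point on level k has letters in the alphabet of 2^k-bit words; only the
   bits below 2^k are observed. *)
Definition letter_class (z : int) (x : tagged_shift_space) : set tagged_shift_space :=
  [set y | y.1 = x.1 /\ forall j, (j < 2 ^ x.1)%N -> y.2 z j = x.2 z j].

Definition letters : set (set tagged_shift_space) := range (letter_class 0).

Lemma shift_by_letter_class a z x :
  shift_by a @^-1` letter_class z x = letter_class (z + a) (shift_by (- a) x).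
Proof.
by apply/seteqP; split=> y /= [kE h]; split=> // j jk; move: (h j jk);
  rewrite /= addrK.
Qed.

(** The i-th iterate of the shift carries coordinate 0 to coordinate -i. Direct images are handled
    as preimages under the inverse. *)
Lemma partition_shift_letters (i : int) :
  partition_shift (shift_by 1) i letters = range (letter_class (- i)).
Proof.
case: i => n; rewrite /partition_shift iter_shift /letters.
  have E A : shift_by n%:Z @` A = shift_by (- n%:Z) @^-1` A.
    apply/seteqP; split=> [_ [x Ax <-]|x Ax]; first by rewrite /= shift_byK.
    by exists (shift_by (- n%:Z) x) => //; rewrite shift_byNK.
  apply/seteqP; split=> [_ [_ [x _ <-] <-]|_ [x _ <-]].
    by rewrite E shift_by_letter_class add0r; eexists.
  exists (letter_class 0 (shift_by (- n%:Z) x)); first by eexists.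
  by rewrite E shift_by_letter_class add0r opprK shift_byNK.
apply/seteqP; split=> [_ [_ [x _ <-] <-]|_ [x _ <-]].
  by rewrite shift_by_letter_class add0r NegzE opprK; eexists.
exists (letter_class 0 (shift_by n.+1%:Z x)); first by eexists.
by rewrite shift_by_letter_class add0r shift_byK NegzE opprK.
Qed.

(** Generating the sigma-algebra by the translates of [letters] makes [letters] a generator for
    every measure, with no null sets to discard. *)
Definition letter_generators : set (set tagged_shift_space) :=
  \bigcup_(i in [set: int]) partition_shift (shift_by 1) i letters.

Definition shift_space : measurableType letter_generators.-sigma :=
  g_sigma_algebraType letter_generators.

Lemma measurable_letter_class z x :
  measurable (letter_class z x : set shift_space).
Proof.
apply: sub_sigma_algebra; exists (- z) => //.
by rewrite partition_shift_letters opprK; exists x.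
Qed.

Lemma measurable_to_shift_space d (T : measurableType d) (f : T -> shift_space) :
  (forall z x, measurable (f @^-1` letter_class z x)) -> measurable_fun setT f.
Proof.
move=> mf; apply: (@measurability _ _ _ shift_space _ _ letter_generators) => //.
move=> _ [B [i _ +] <-]; rewrite partition_shift_letters setTI => -[x _ <-].
exact: mf.
Qed.

Lemma measurable_shift_by a :
  measurable_fun setT (shift_by a : shift_space -> shift_space).
Proof.
apply: measurable_to_shift_space => z x.
by rewrite shift_by_letter_class; exact: measurable_letter_class.
Qed.

Definition shift : shift_space -> shift_space := shift_by 1.

Lemma automorphism_shift : measurable_automorphism shift.
Proof.
exists (shift_by (-1)); split; [exact: shift_byK|exact: shift_byNK| |];
  exact: measurable_shift_by.
Qed.

(** A class is determined by its level k and the 2^k observed bits at time 0, hence by an element of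
    a countable type. *)
Lemma countable_letters : countable letters.
Proof.
pose code (x : tagged_shift_space) := (x.1, mkseq (x.2 0) (2 ^ x.1)).
have codeE x y : code x = code y -> letter_class 0 x = letter_class 0 y.
  move=> [kE wE]; rewrite -kE in wE.
  have xy j : (j < 2 ^ x.1)%N -> x.2 0 j = y.2 0 j.
    by move=> jk; rewrite -(nth_mkseq false (x.2 0) jk) wE nth_mkseq.
  apply/seteqP; split=> z [zk zw].
    by split=> [|j]; rewrite -kE// => jk; rewrite zw// xy.
  by split=> [|j jk]; rewrite ?kE// xy// zw// -kE.
pose dec (c : nat * seq bool) := letter_class 0 (c.1, fun _ => nth false c.2).
apply: (sub_countable _ (countableP [set: nat * seq bool])).
apply: card_le_trans (card_image_le dec setT).
apply: subset_card_le => _ [x _ <-]; exists (code x) => //.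
apply: codeE; rewrite /code/=; congr pair.
by apply: (@eq_from_nth _ false); rewrite !size_mkseq// => i ik; rewrite !nth_mkseq.
Qed.

Lemma measurable_partition_letters : measurable_partition (letters : set (set shift_space)).
Proof.
split; last by move=> _ [x _ <-]; exact: measurable_letter_class.
split.
- by apply/seteqP; split=> // x _; exists (letter_class 0 x) => //; exists x.
- move=> _ _ [x _ <-] [y _ <-] [z [[zx zxw] [zy zyw]]].
  have xyk : x.1 = y.1 by rewrite -zx -zy.
  apply/seteqP; split=> t [tk tw]; split; rewrite ?tk// => j jk.
    by rewrite tw ?xyk// -zyw// -zxw// xyk.
  by rewrite tw -?xyk// -zxw// -zyw// -xyk.
- by move=> _ [x _ <-]; exists x.
Qed.

Lemma generator_letters (R : realType) (mu : probability shift_space R) :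
  partition_generator shift mu letters.
Proof.
split; [exact: measurable_partition_letters|exact: countable_letters|].
by split=> A mA; exists A => //; rewrite setYK measure0.
Qed.

(** * Periodic and Bernoulli processes driven by coins *)

Definition coin_array := coin_space (int * nat).

Definition read_index (k : nat) (per : bool) (i : int) : int :=
  if per then (i %% k.+1%:Z)%Z else i.

(** Unobserved bits are set to [false], so that the periodic process has only finitely many sample
    points. *)
Definition process (k : nat) (per : bool) (w : coin_array) : shift_space :=
  (k, fun i j => (j < 2 ^ k)%N && w (read_index k per i, j)).

Lemma process_letter_class k per z x :
  process k per @^-1` letter_class z x =
  if k == x.1 then
    \bigcap_(j in `I_(2 ^ k)) [set w | w (read_index k per z, j) = x.2 z j]
  else set0.
Proof.
case: eqP => [kx|kx]; last by apply/seteqP; split=> // w [].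
apply/seteqP; split=> w.
  by move=> [_ h] j /= jk; move: (h j); rewrite -kx /process/= jk => /(_ isT).
by move=> h; split=> // j; rewrite -kx /process/= => jk; rewrite jk; exact: h.
Qed.

Lemma measurable_process k per : measurable_fun setT (process k per).
Proof.
apply: measurable_to_shift_space => z x; rewrite process_letter_class.
case: eqP => // _; apply: fin_bigcap_measurable => // j _.
exact: measurable_coin.
Qed.

HB.instance Definition _ k per :=
  isMeasurableFun.Build _ _ _ _ (process k per) (measurable_process k per).

(** * Mixtures of periodic and Bernoulli processes *)

Section mixture.
Variable R : realType.

Definition level_weight (k : nat) : R := 1 / (2 ^ k.+1)%:R.

Lemma level_weight_ge0 k : 0 <= level_weight k.
Proof. by rewrite /level_weight divr_ge0. Qed.

Lemma level_weight_tail K : (\sum_(K <= k <oo) (level_weight k)%:E = (1 / 2 ^+ K)%:E)%E.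
Proof.
rewrite -nneseries_addn; last by move=> k; rewrite lee_fin level_weight_ge0.
transitivity (\sum_(k <oo) (1 / (2 ^ (k + K.+1))%:R : R)%:E)%E.
  by apply: eq_eseriesr => k _; rewrite /level_weight addnS.
by apply/cvg_lim => //; exact: cvg_geometric_eseries_half.
Qed.

Definition process_law k per : probability shift_space R :=
  distribution (coin R (int * nat)%type) (process k per).

(* B selects the levels that carry the Bernoulli law; the other levels carry
   the periodic one. *)
Definition mixture (B : pred nat) : set shift_space -> \bar R :=
  mseries (fun k => mscale (NngNum (level_weight_ge0 k)) (process_law k (~~ B k))) 0.

HB.instance Definition _ B := Measure.copy (mixture B)
  (mseries (fun k => mscale (NngNum (level_weight_ge0 k)) (process_law k (~~ B k))) 0).

Lemma mixtureE B A : (mixture B A =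
  \sum_(k <oo) (level_weight k)%:E * process_law k (~~ B k) A)%E.
Proof. by []. Qed.

Lemma mixture_setT B : mixture B setT = 1%E.
Proof.
rewrite mixtureE; under eq_eseriesr do rewrite probability_setT mule1.
by rewrite level_weight_tail expr0 divr1.
Qed.

HB.instance Definition _ B :=
  Measure_isProbability.Build _ _ _ (mixture B) (mixture_setT B).

(** This map turns the time shift into a relabelling of coins. In the periodic case it is a cyclic
    permutation of 0, ..., k, extended by the identity to be injective on all integers, as
    [coin_reindex] requires. *)
Definition next_index (k : nat) (per : bool) (i : int) : int :=
  if per then if (0 <= i < k.+1%:Z) then ((i + 1) %% k.+1%:Z)%Z else i else i + 1.

Lemma read_indexS k per i :
  read_index k per (i + 1) = next_index k per (read_index k per i).
Proof.
rewrite /read_index /next_index; case: per => //.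
by rewrite modz_ge0// ltz_pmod// modzDml.
Qed.

Lemma next_index_inj k per : injective (next_index k per).
Proof.
rewrite /next_index; case: per => i j; last by move/addIr.
have mod01 x : 0 <= x < k.+1%:Z ->
    ((x + 1) %% k.+1%:Z)%Z = if x == k%:Z then 0 else x + 1.
  move=> xk; case: eqP => [->|xnk]; first by rewrite addrC -intS modzz.
  by rewrite modz_small//; lia.
by case: ifPn => ik; case: ifPn => jk; rewrite ?mod01//; do ?case: eqP; lia.
Qed.

Lemma shift_process k per w : shift (process k per w) =
  process k per (reindex (fun a => (next_index k per a.1, a.2)) w).
Proof.
by congr pair; apply/funext => i; apply/funext => j; rewrite /= read_indexS.
Qed.

(** On each level [process] intertwines the shift with an injective reindexing of the coins, which
    preserves [coin]. *)
Lemma invariant_mixture B : invariant_measure shift (mixture B).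
Proof.
move=> A mA; rewrite /= !mixtureE; apply: eq_eseriesr => k _; congr (_ * _)%E.
rewrite /process_law /= /distribution /pushforward.
rewrite -[RHS](@coin_reindex _ _ (fun a => (next_index k (~~ B k) a.1, a.2))).
- by congr (coin _ _ _); apply/seteqP; split=> w /=; rewrite shift_process.
- by move=> [a j] [b l] [/next_index_inj-> ->].
- by rewrite -[X in measurable X]setTI; exact: measurable_process.
Qed.

Lemma dynamical_join_lettersE n A : dynamical_join shift letters n A ->
  exists F, (forall i : nat, (i < n)%N -> range (letter_class i) (F i)) /\
    A = \bigcap_(i < n) F i.
Proof.
move=> [_ [F hF ->]]; exists F; split=> // i /hF.
by rewrite partition_shift_letters opprK.
Qed.

(* The periodic and the Bernoulli process of level n read the same coins
   during one period. *)
Lemma mixture_join n A : dynamical_join shift letters n.+1 A ->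
  mixture pred0 A = mixture (pred1 n) A.
Proof.
move=> /dynamical_join_lettersE[F [hF ->]]; rewrite !mixtureE.
apply: eq_eseriesr => k _; congr (_ * _)%E; rewrite /=.
case: eqP => //= ->; rewrite /process_law /= /distribution /pushforward.
congr (coin _ _ _); rewrite !preimage_bigcap; apply: eq_bigcapr => i /= ni.
have [x _ <-] := hF i ni; rewrite !process_letter_class /read_index.
by rewrite modz_small.
Qed.

Lemma finite_range_periodic_process k : finite_set (range (process k true)).
Proof.
(* A sample point depends only on the coins in k+1 columns and 2^k rows. The extra row makes the
   ordinal type a successor, as [inord] requires. *)
pose decode (f : {ffun 'I_k.+1 * 'I_(2 ^ k).+1 -> bool}) : shift_space :=
  (k, fun i j => (j < 2 ^ k)%N && f (inord `|(i %% k.+1%:Z)%Z|, inord j)).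
apply: (@sub_finite_set _ _ (range decode)); last exact: finite_image.
move=> _ [w _ <-].
exists [ffun a : 'I_k.+1 * 'I_(2 ^ k).+1 => w ((val a.1)%:Z, val a.2)] => //.
congr pair; apply/funext => i; apply/funext => j.
case: ltnP => //= jk; rewrite ffunE /=; congr w; congr pair.
  by rewrite inordK ?gez0_abs ?modz_ge0// -ltz_nat gez0_abs ?modz_ge0// ltz_pmod.
by rewrite inordK// ltnW.
Qed.

(** [Y] collects the finitely many sample points of the levels below [K]; the remaining levels have
    total weight 2^-K < e. *)
Lemma periodic_mixture_almost_finite (e : R) : 0 < e ->
  exists2 Y : set shift_space, finite_set Y &
    forall A, measurable A -> A `&` Y = set0 -> (mixture pred0 A <= e%:E)%E.
Proof.
move=> e0.
have [K eK] : exists K, 1 / 2 ^+ K < e.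
  have := @cvg_geometric R 1 (2^-1); rewrite ger0_norm// invf_lt1// ltr1n.
  move=> /(_ isT) /cvgrPdist_lt/(_ _ e0)[K _ /(_ K (leqnn K))] /=.
  rewrite sub0r normrN ger0_norm ?mulr_ge0 ?exprn_ge0// exprVn => h.
  by exists K.
exists (\bigcup_(k in `I_K) range (process k true)).
  by apply: bigcup_finite => // k _; exact: finite_range_periodic_process.
move=> A mA AY; rewrite mixtureE (nneseries_split 0%N K); last first.
  by move=> k _; rewrite mule_ge0// lee_fin level_weight_ge0.
rewrite add0n big_nat_cond big1 ?add0e; last first.
  move=> k /andP[/andP[_ kK] _]; rewrite /process_law /= /distribution /pushforward.
  rewrite (_ : _ @^-1` _ = set0) ?measure0 ?mule0//.
  apply/seteqP; split=> // w /= Aw.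
  have : (A `&` \bigcup_(i < K) range (process i true)) (process k true (toss w)).
    by split; [exact: Aw|exists k => //; exists (toss w)].
  by rewrite AY.
apply: (@le_trans _ _ (1 / 2 ^+ K)%:E); last by rewrite lee_fin ltW.
rewrite -level_weight_tail; apply: lee_nneseries => k _.
  by rewrite mule_ge0// lee_fin level_weight_ge0.
by rewrite -[leRHS]mule1 lee_wpmul2l ?lee_fin ?level_weight_ge0// probability_le1.
Qed.

End mixture.

(** * Measures almost carried by finite sets have entropy zero *)

Lemma entropy_term_ge0 (R : realType) (b : R) : 0 <= b <= 1 -> 0 <= - (b * ln b).
Proof. by move=> /andP[b0 b1]; rewrite -mulrN mulr_ge0// oppr_ge0 ln_le0. Qed.

(** For b > 0 this is ln x < x at x = 1/(bN). Summed over at most N atoms of total mass at most e,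
    it gives 1 + e ln N. *)
Lemma entropy_term_le (R : realType) (b : R) (N : nat) : (0 < N)%N -> 0 <= b ->
  - (b * ln b) <= N%:R^-1 + b * ln N%:R.
Proof.
move=> N0; rewrite le_eqVlt => /predU1P[<-|b0].
  by rewrite !mul0r oppr0 addr0 invr_ge0.
have NR : 0 < N%:R :> R by rewrite ltr0n.
have bN : 0 < b * N%:R by rewrite mulr_gt0.
have : b * ln (b * N%:R)^-1 <= N%:R^-1.
  rewrite -[leRHS](mulKf (lt0r_neq0 b0)) mulrCA -invfM ler_pM2l// ltW//.
  by rewrite ln_sublinear// invr_gt0.
by rewrite lnV ?posrE// lnM ?posrE//; lra.
Qed.

Lemma entropy_term_le1 (R : realType) (b : R) : 0 <= b -> - (b * ln b) <= 1.
Proof.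
by move=> b0; have := entropy_term_le (ltn0Sn 0) b0; rewrite invr1 ln1 mulr0 addr0.
Qed.

Section almost_finite_support.
Variables (d : measure_display) (X : measurableType d) (R : realType).
Variable mu : probability X R.

Let mass01 A : measurable A -> 0 <= fine (mu A) <= 1.
Proof.
move=> mA; rewrite fine_ge0//= -lee_fin fineK ?fin_num_measure//.
exact: probability_le1.
Qed.

Lemma partition_entropy_seq (s : seq (set X)) : uniq s ->
  (forall A, A \in s -> measurable A) ->
  partition_entropy mu [set` s] =
  (\sum_(A <- s) - (fine (mu A) * ln (fine (mu A))))%:E.
Proof.
move=> us ms; rewrite /partition_entropy esum_fset; [|exact: finite_seq|]; last first.
  by move=> A; rewrite inE /= => /ms mA; rewrite lee_fin entropy_term_ge0// mass01.
by rewrite -fsbig_seq// sumEFin.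
Qed.

(* Atoms meeting t contribute at most 1 each and, being disjoint, number at most
   size t; the others have total mass at most e. *)
Lemma partition_entropy_le (s : seq (set X)) (t : seq X) (e : R) (N : nat) :
  uniq s -> (forall A, A \in s -> measurable A) -> trivIset [set` s] id ->
  (size s <= N)%N -> (0 < N)%N ->
  (forall A, measurable A -> A `&` [set` t] = set0 -> (mu A <= e%:E)%E) ->
  \sum_(A <- s) - (fine (mu A) * ln (fine (mu A))) <=
    (size t)%:R + 1 + e * ln N%:R.
Proof.
move=> us ms tI sN N0 mue.
pose meets (A : set X) := has (fun y => y \in A) t.
have disj A B y : A \in s -> B \in s -> A y -> B y -> A = B.
  by move=> sA sB Ay By; apply: (tI A B sA sB); exists y.
rewrite (bigID meets)/= -addrA lerD//.
  rewrite -big_filter (@le_trans _ _ (\sum_(A <- [seq A <- s | meets A]) 1))//.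
    rewrite big_seq [leRHS]big_seq ler_sum// => A; rewrite mem_filter => /andP[_ sA].
    by apply: entropy_term_le1; have /andP[] := mass01 (ms _ sA).
  rewrite big_const_seq count_predT iter_addr_0 ler_nat.
  case: t @meets {mue} => [|y0 t'] meets; first by rewrite filter_pred0.
  set t := y0 :: t' in meets *.
  (* [pt] picks the first point of [t] in an atom; disjointness makes it injective on the atoms that
     meet [t]. *)
  pose pt (A : set X) := nth y0 t (find (fun y => y \in A) t).
  have ptP A : meets A -> A (pt A).
    by move=> mA; apply: set_mem; exact: (nth_find y0 mA).
  rewrite -(size_map pt) uniq_leq_size//.
    rewrite map_inj_in_uniq ?filter_uniq// => A B.
    rewrite !mem_filter => /andP[/ptP mA sA] /andP[/ptP mB sB] AB.
    by apply: (disj A B (pt A)) => //; rewrite AB.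
  move=> y /mapP[A]; rewrite mem_filter => /andP[mA _] ->.
  by rewrite mem_nth// -has_find.
rewrite -big_filter; set s' := [seq A <- s | ~~ meets A].
have ms' A : A \in s' -> measurable A by rewrite mem_filter => /andP[_ /ms].
have NR : 0 < N%:R :> R by rewrite ltr0n.
have lnN : 0 <= ln N%:R :> R by rewrite ln_ge0// ler1n.
apply: (@le_trans _ _ (\sum_(A <- s') (N%:R^-1 + fine (mu A) * ln N%:R))).
  rewrite big_seq [leRHS]big_seq ler_sum// => A sA.
  by apply: entropy_term_le => //; have /andP[] := mass01 (ms' _ sA).
rewrite big_split/= -big_distrl/= lerD//.
  rewrite big_const_seq count_predT iter_addr_0 -[leLHS]mulr_natl ler_pdivrMr// mul1r.
  by rewrite ler_nat (leq_trans _ sN)// size_filter count_size.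
rewrite ler_wpM2r// -lee_fin -sumEFin.
have us' : uniq s' by rewrite filter_uniq.
(* The smallness hypothesis is applied once, to the union of the remaining atoms, rather than atom
   by atom. *)
have -> : (\sum_(A <- s') (fine (mu A))%:E = mu (\bigcup_(A in [set` s']) A))%E.
  rewrite (measure_fin_bigcup mu (finite_seq s')).
  - rewrite -fsbig_seq// big_seq [RHS]big_seq; apply: eq_bigr => A sA.
    by rewrite fineK// fin_num_measure//; exact: ms'.
  - by move=> A B; rewrite /= !mem_filter => /andP[_ sA] /andP[_ sB]; exact: tI.
  - exact: ms'.
apply: mue; first by apply: fin_bigcup_measurable (finite_seq s') _.
apply/seteqP; split=> // y [[A /= sA Ay] ty].
move: sA; rewrite mem_filter => /andP[/hasPn/(_ y ty)].
by rewrite mem_set.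
Qed.

End almost_finite_support.

Section zero_entropy.
Variables (d : measure_display) (X : measurableType d) (R : realType).
Variables (mu : probability X R) (T : X -> X).
Hypothesis autT : measurable_automorphism T.

Lemma measurable_iter_preimage n A : measurable A -> measurable (iter n T @^-1` A).
Proof.
have [_ [_ _ mT _]] := autT; elim: n => // n IH mA.
rewrite (_ : _ @^-1` _ = T @^-1` (iter n T @^-1` A)).
  by rewrite -[X in measurable X]setTI; apply: mT => //; exact: IH.
by apply/seteqP; split=> x; rewrite /= -iterSr.
Qed.

(** Only n = 0 needs care: its opposite is encoded as a nonnegative integer, hence as a direct image
    under the identity. *)
Lemma partition_shiftN (Y : Type) (U : Y -> Y) P (n : nat) :
  partition_shift U (- n%:Z) P = [set iter n U @^-1` A | A in P].
Proof.
case: n => [|n] //=; apply: eq_imagel => A _.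
by rewrite image_id.
Qed.

Lemma dynamical_joinP (Y : Type) (U : Y -> Y) P n B :
  dynamical_join U P n B <-> B !=set0 /\ exists2 A : nat -> set Y,
    (forall i, (i < n)%N -> P (A i)) & B = \bigcap_(i < n) iter i U @^-1` A i.
Proof.
split=> [[B0 [F hF BE]]|[B0 [A hA BE]]].
  split=> //.
  have /choice[A hA] i : exists Ai, (i < n)%N -> P Ai /\ F i = iter i U @^-1` Ai.
    have [ni|] := ltnP i n; last by move=> _; exists set0.
    have := hF i ni; rewrite partition_shiftN => -[Ai PAi <-].
    by exists Ai.
  exists A; first by move=> i /hA[].
  by rewrite BE; apply: eq_bigcapr => i /hA[].
split=> //; exists (fun i => iter i U @^-1` A i) => // i ni.
by rewrite partition_shiftN; exists (A i) => //; exact: hA.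
Qed.

(** The list has one intersection per word of n atoms, empty and repeated ones included, whence an
    inclusion and an upper bound. *)
Lemma dynamical_join_size (Y : Type) (U : Y -> Y) (s : seq (set Y)) n :
  exists2 l, dynamical_join U [set` s] n `<=` [set` l] & (size l <= size s ^ n)%N.
Proof.
suff [l ll sl] : exists2 l : seq (set Y),
    (forall A : nat -> set Y, (forall i, (i < n)%N -> A i \in s) ->
      \bigcap_(i < n) iter i U @^-1` A i \in l) & (size l <= size s ^ n)%N.
  by exists l => // B /dynamical_joinP[_ [A hA ->]]; exact: ll.
elim: n => [|n [l ll sl]].
  exists [:: setT] => // A _; rewrite inE; apply/eqP.
  by apply/seteqP; split.
exists [seq B `&` iter n U @^-1` C | B <- l, C <- s].
  move=> A hA; apply/allpairsP.
  exists (\bigcap_(i < n) iter i U @^-1` A i, A n); split => /=.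
  - by apply: ll => i ni; apply: hA; exact: leqW.
  - exact: hA.
  apply/seteqP; split=> x /=.
    by move=> h; split=> [i ni|]; apply: h => //=; exact: leqW.
  by move=> [h hn] i /=; rewrite ltnS leq_eqVlt => /predU1P[->//|]; exact: h.
by rewrite size_allpairs expnSr leq_mul2r sl orbT.
Qed.

Lemma measurable_dynamical_join (P : set (set X)) n B :
  P `<=` measurable -> dynamical_join T P n B -> measurable B.
Proof.
move=> mP /dynamical_joinP[_ [A hA ->]]; apply: fin_bigcap_measurable => //.
by move=> i ni; apply: measurable_iter_preimage; apply: mP; exact: hA.
Qed.

(** The n-th join has at most (|s|+1)^n atoms, so [partition_entropy_le] bounds its entropy by a
    constant plus a small multiple of n ln(|s|+1); division by n leaves an arbitrarily small limit.
    The base |s|+1 keeps the count positive. *)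
Lemma entropy_rate0 (P : set (set X)) :
  (forall e : R, 0 < e -> exists2 Y : set X, finite_set Y &
    forall A, measurable A -> A `&` Y = set0 -> (mu A <= e%:E)%E) ->
  measurable_partition P -> finite_set P -> entropy_rate T mu P = 0%E.
Proof.
move=> Yfin [[_ tP _] mP] /finite_seqP[s PE].
have mJ n B : dynamical_join T P n B -> measurable B.
  exact: measurable_dynamical_join.
have tJ n : trivIset (dynamical_join T P n) id.
  move=> B C /dynamical_joinP[_ [A hA ->]] /dynamical_joinP[_ [A' hA' ->]].
  move=> [x [xA xA']]; apply: eq_bigcapr => i ni; congr (_ @^-1` _).
  by apply: (tP _ _ (hA i ni) (hA' i ni)); exists (iter i T x); split;
    [exact: xA|exact: xA'].
have /choice[l hl] n : exists l : seq (set X), [/\ uniq l,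
    dynamical_join T P n = [set` l] & (size l <= (size s).+1 ^ n)%N].
  have [l ll sl] := dynamical_join_size T s n.
  exists [seq B <- undup l | `[< dynamical_join T P n B >]]; split.
  - by rewrite filter_uniq// undup_uniq.
  - apply/seteqP; split=> [B JB|B] /=; rewrite mem_filter mem_undup.
      by rewrite asboolT//=; apply: ll; rewrite -PE.
    by move=> /andP[/asboolP].
  - rewrite size_filter (leq_trans (count_size _ _))//.
    rewrite (leq_trans (size_undup _))// (leq_trans sl)//; case: (n) => // m.
    by rewrite leq_exp2r// leqnSn.
pose u n := \sum_(A <- l n) - (fine (mu A) * ln (fine (mu A))).
have uE n : partition_entropy mu (dynamical_join T P n) = (u n)%:E.
  have [ul JE _] := hl n; rewrite JE partition_entropy_seq// => A lA.
  by apply: (mJ n); rewrite JE.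
have u0 n : 0 <= u n.
  have [_ JE _] := hl n; rewrite /u big_seq sumr_ge0// => A lA.
  have mA : measurable A by apply: (mJ n); rewrite JE.
  rewrite entropy_term_ge0// fine_ge0//= -lee_fin fineK ?fin_num_measure//.
  exact: probability_le1.
pose L : R := ln (size s).+1%:R.
have L0 : 0 <= L by rewrite ln_ge0// ler1n.
apply/cvg_lim => //; apply: cvg_EFin.
  by apply: nearW => n; rewrite uE.
apply/cvgrPdist_le => /= e e0.
(* This makes [e' * L] at most e/2, with a positive denominator even if [L] is 0. For large n the
   constant part of the bound takes the other half. *)
pose e' := e / (2 * (L + 1)).
have e'0 : 0 < e' by rewrite divr_gt0// mulr_gt0// ltr_wpDl.
have [Y /finite_seqP[t ->] Yle] := Yfin e' e'0.
have ub n : u n <= (size t)%:R + 1 + e' * (n%:R * L).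
  have [ul JE sl] := hl n.
  have -> : n%:R * L = ln ((size s).+1 ^ n)%:R by rewrite natrX lnXn// mulr_natl.
  apply: partition_entropy_le => //; last by rewrite expn_gt0.
    by move=> A lA; apply: (mJ n); rewrite JE.
  by rewrite -JE; exact: tJ.
near=> n.
have n0 : 0 < n%:R :> R by rewrite ltr0n; near: n; exists 1%N.
have nbig : ((size t)%:R + 1) * 2 / e <= n%:R.
  by near: n; exact: nbhs_infty_ger.
rewrite sub0r normrN uE /= ger0_norm ?mulr_ge0 ?invr_ge0//.
rewrite mulrC ler_pdivrMr// (le_trans (ub n))//.
have -> : e * n%:R = e / 2 * n%:R + e / 2 * n%:R by field.
rewrite lerD//.
  by rewrite mulrAC ler_pdivlMr// (mulrC e) -ler_pdivrMr.
rewrite mulrCA mulrC ler_wpM2r//; rewrite ?ler0n//.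
rewrite /e' mulrAC ler_pdivrMr ?mulr_gt0 ?ltr_wpDl//.
have -> : e / 2 * (2 * (L + 1)) = e * L + e by field.
by rewrite lerDl ltW.
Unshelve. all: by end_near. Qed.

End zero_entropy.

(** * Entropy of the Bernoulli component *)

(** The first m letters of a point on level n. All other levels are lumped into [None], which keeps
    the partition finite. *)
Definition word (n m : nat) (x : shift_space) : option {ffun 'I_m * 'I_(2 ^ n) -> bool} :=
  if x.1 == n then Some [ffun a => x.2 (val a.1)%:Z (val a.2)] else None.

Definition word_fiber n m a : set shift_space := word n m @^-1` [set a].

Definition word_partition n m : set (set shift_space) := range (@word_fiber n m).

Lemma word_surj n m a : exists x, word n m x = a.
Proof.
case: a => [w|]; last first.
  by exists (n.+1, fun _ _ => false); rewrite /word /= gtn_eqF.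
pose letter (i : int) (j : nat) :=
  if (insub `|i|%N : option 'I_m, insub j : option 'I_(2 ^ n)) is (Some a, Some b)
  then w (a, b) else false.
exists (n, letter); rewrite /word eqxx; congr Some.
by apply/ffunP => -[a b]; rewrite ffunE /letter /= !valK.
Qed.

Lemma word_eqP n m x y : word n m x = word n m y <->
  (x.1 == n) = (y.1 == n) /\
  (x.1 = n -> forall i j, (i < m)%N -> (j < 2 ^ n)%N -> x.2 i%:Z j = y.2 i%:Z j).
Proof.
rewrite /word; case: eqP => [xn|xn]; case: eqP => yn; split=> //; try by case.
- move=> [/ffunP h]; split=> // _ i j im jn.
  have := h (Ordinal im, Ordinal jn); rewrite !ffunE; exact: id.
- move=> [_ /(_ xn) h]; congr Some; apply/ffunP => -[a b]; rewrite !ffunE /=.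
  exact: h.
Qed.

Lemma word_iter n m x y : (0 < m)%N -> word n m x = word n m y <->
  forall i, (i < m)%N -> word n 1 (iter i shift x) = word n 1 (iter i shift y).
Proof.
move=> m0; rewrite word_eqP; split=> [[xyn xy] i im|h].
  rewrite iter_shift; apply/word_eqP; split=> //= xn i' j i'0 jn.
  by rewrite -PoszD xy//; lia.
have /word_eqP[xyn _] := h 0%N m0; split=> // xn i j im jn.
have := h i im; rewrite iter_shift => /word_eqP[_ /(_ xn 0%N j isT jn)].
by rewrite /= add0r.
Qed.

(** The word of length m records the one-letter words along the orbit. For m = 0 the join would be
    trivial, while the word still sees whether the level is n. *)
Lemma dynamical_join_word n m : (0 < m)%N ->
  dynamical_join shift (word_partition n 1) m = word_partition n m.
Proof.
move=> m0; apply/seteqP; split=> [B /dynamical_joinP[[x Bx] [A hA BE]]|_ [a _ <-]].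
  have AE i : (i < m)%N -> A i = word_fiber (word n 1 (iter i shift x)).
    move=> im; have [a _ aE] := hA i im.
    have : A i (iter i shift x) by move: Bx; rewrite BE => /(_ i im).
    by rewrite -aE /word_fiber /= => ->.
  exists (word n m x) => //; rewrite BE; apply/seteqP; split=> y.
    by move=> /word_iter yx i im; rewrite AE//; exact: yx.
  by move=> yB; apply/word_iter => // i im; have := yB i im; rewrite AE.
have [x xa] := word_surj a; apply/dynamical_joinP; split; first by exists x.
exists (fun i => word_fiber (word n 1 (iter i shift x))); first by move=> i _; eexists.
apply/seteqP; split=> y; rewrite /word_fiber /= -xa.
  by move=> /word_iter yx i im; exact: yx.
by move=> yB; apply/word_iter => // i im; exact: yB.
Qed.

Lemma word_fiber_inj n m : injective (@word_fiber n m).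
Proof.
move=> a b ab; have [x xa] := word_surj a.
have : word_fiber a x by [].
by rewrite ab => <-.
Qed.

Lemma word_fiber_None n m : word_fiber (None : option {ffun 'I_m * 'I_(2 ^ n) -> bool}) =
  [set x | x.1 != n].
Proof. by apply/seteqP; split=> x; rewrite /word_fiber /word /=; case: eqP. Qed.

Lemma measurable_word_fiber n m a : (0 < m)%N -> measurable (@word_fiber n m a).
Proof.
move=> m0.
have mS w : measurable (@word_fiber n m (Some w)).
  have [x xw] := word_surj (Some w).
  have xn : x.1 = n by move: xw; rewrite /word; case: eqP.
  rewrite (_ : word_fiber _ = \bigcap_(i < m) letter_class i%:Z x).
    by apply: fin_bigcap_measurable => // i _; exact: measurable_letter_class.
  rewrite -xw; apply/seteqP; split=> y.
    move=> /word_eqP[]; rewrite xn eqxx => /eqP yn yx i im; split; first by rewrite yn.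
    by move=> j; rewrite xn; exact: yx.
  move=> yx; have [yn _] := yx 0%N m0; apply/word_eqP; rewrite yn; split=> // _ i j im jn.
  by have [_ h] := yx i im; rewrite h// xn.
case: a => // ; rewrite word_fiber_None.
rewrite (_ : mkset _ = ~` \bigcup_(w in [set: {ffun 'I_m * 'I_(2 ^ n) -> bool}])
    word_fiber (Some w)).
  by apply: measurableC; apply: fin_bigcup_measurable.
apply/seteqP; split=> x /=.
  by move=> xn [w _]; rewrite /word_fiber/= /word (negbTE xn).
apply: contra_not_neq => xn; exists [ffun a => x.2 (val a.1)%:Z (val a.2)] => //.
by rewrite /word_fiber /= /word xn eqxx.
Qed.

Lemma measurable_word_partition n : measurable_partition (word_partition n 1).
Proof.
split; last by move=> _ [a _ <-]; exact: measurable_word_fiber.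
split.
- by apply/seteqP; split=> // x _; exists (word_fiber (word n 1 x)) => //; eexists.
- by move=> _ _ [a _ <-] [b _ <-] [x []]; rewrite /word_fiber /= => -> ->.
- by move=> _ [a _ <-]; have [x <-] := word_surj a; exists x.
Qed.

Lemma finite_word_partition n m : finite_set (word_partition n m).
Proof. exact: finite_image. Qed.

Section bernoulli_level.
Variable (R : realType).

(** Only level n charges this fibre, and its Bernoulli law reads m 2^n distinct coins there, listed
    in [s]. *)
Lemma mixture_word n m (w : {ffun 'I_m * 'I_(2 ^ n) -> bool}) :
  mixture R (pred1 n) (word_fiber (Some w)) =
  (level_weight R n / 2 ^+ (m * 2 ^ n))%:E.
Proof.
have [x xw] := word_surj (Some w).
have xn : x.1 = n by move: xw; rewrite /word; case: eqP.
rewrite mixtureE (@nneseriesD1 _ _ n)//; last first.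
  by move=> k _; rewrite mule_ge0// lee_fin level_weight_ge0.
rewrite eseries0 ?adde0; last first.
  move=> k _ /= kn; rewrite /process_law /= /distribution /pushforward.
  rewrite (_ : _ @^-1` _ = set0) ?measure0 ?mule0//.
  by apply/seteqP; split=> // t; rewrite /word_fiber /= /word /= (negbTE kn).
rewrite (_ : ~~ pred1 n n = false); last by rewrite /= eqxx.
pose s := [seq ((val a.1)%:Z, val a.2) | a : 'I_m * 'I_(2 ^ n)].
have us : uniq s.
  rewrite map_inj_uniq ?enum_uniq// => -[a b] [a' b'] [/val_inj-> /val_inj->] //.
have ss : size s = (m * 2 ^ n)%N by rewrite size_map -cardE card_prod !card_ord.
rewrite [RHS]EFinM; congr (_ * _)%E; rewrite -ss.
rewrite -(@coin_word R _ s (fun a => x.2 a.1 a.2) us).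
rewrite /process_law /= /distribution /pushforward; congr (coin _ _ _).
rewrite -xw; apply/seteqP; split=> t.
  move=> /word_eqP[_ /(_ erefl)] h _ /mapP[[a b] _ ->] /=.
  by rewrite -h//= ltn_ord.
move=> h; apply/word_eqP; rewrite /= eqxx xn eqxx; split=> // _ i j im jn.
rewrite jn /= /read_index; apply: (h (i%:Z, j)).
by apply/mapP; exists (Ordinal im, Ordinal jn); rewrite ?mem_enum.
Qed.

(** Besides the [None] atom of mass b there are q = 2^(m 2^n) atoms of mass p/q. They contribute - p
    ln p + p ln q, and p 2^n = 1/2 turns p ln q into m ln 2 / 2. *)
Lemma partition_entropy_word (n m : nat) : (0 < m)%N ->
  let b := fine (mixture R (pred1 n) [set x | x.1 != n]) in
  let p := level_weight R n in
  partition_entropy (mixture R (pred1 n)) (word_partition n m) =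
  (- (b * ln b) - p * ln p + m%:R * (ln 2 / 2))%:E.
Proof.
move=> m0 b p.
pose S := [seq word_fiber (Some w) | w : {ffun 'I_m * 'I_(2 ^ n) -> bool}].
have SE : word_partition n m = [set` @word_fiber n m None :: S].
  apply/seteqP; split=> [_ [[w|] _ <-]|A] /=.
  - by rewrite inE; apply/orP; right; apply/mapP; exists w; rewrite ?mem_enum.
  - by rewrite inE eqxx.
  - by rewrite inE => /predU1P[->|/mapP[w _ ->]]; eexists.
have p0 : 0 < p by rewrite divr_gt0// ltr0n expn_gt0.
rewrite SE partition_entropy_seq; first last.
- by move=> A; rewrite inE => /predU1P[->|/mapP[w _ ->]]; exact: measurable_word_fiber.
- rewrite /= map_inj_uniq ?enum_uniq ?andbT; last by move=> v w /word_fiber_inj[].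
  by apply/mapP => -[w _ /word_fiber_inj].
rewrite big_cons word_fiber_None -addrA; congr (_ + _)%:E.
rewrite big_map (eq_bigr (fun=> - (p / 2 ^+ (m * 2 ^ n) * ln (p / 2 ^+ (m * 2 ^ n))))).
  rewrite big_enum sumr_const card_ffun card_bool card_prod !card_ord -[LHS]mulr_natl natrX.
  set q := 2 ^+ (m * 2 ^ n).
  have q0 : 0 < q :> R by rewrite exprn_gt0.
  rewrite ln_div ?posrE// /q lnXn// -/q -[ln 2 *+ _]mulr_natl natrM.
  have -> : ln 2 / 2 = p * (2 ^ n)%:R * ln 2 :> R.
    rewrite /p /level_weight expnS natrM; field.
    by rewrite pnatr_eq0 -lt0n expn_gt0.
  by field; exact: lt0r_neq0.
by move=> w _; rewrite [X in fine X](mixture_word w).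
Qed.

Lemma entropy_rate_word n :
  entropy_rate shift (mixture R (pred1 n)) (word_partition n 1) = (ln 2 / 2)%:E.
Proof.
pose b : R := fine (mixture R (pred1 n) [set x | x.1 != n]).
pose p := level_weight R n.
pose c := - (b * ln b) - p * ln p.
(* The index is shifted because the entropy formula is for m > 0; the part [c], free of m, then
   vanishes against [harmonic]. *)
apply/cvg_lim => //; rewrite -cvg_shiftS.
rewrite (_ : [sequence _]_n = fun m => (c * harmonic m + ln 2 / 2)%:E); last first.
  apply/funext => m /=; rewrite dynamical_join_word// partition_entropy_word//.
  by rewrite -EFinM mulrDr mulKf ?pnatr_eq0// mulrC.
apply: cvg_EFin; first exact: nearW.
rewrite -[X in _ --> X]add0r -[X in _ --> X + _](mulr0 c).
by apply: cvgD; [apply: cvgMr; exact: cvg_harmonic|exact: cvg_cst].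
Qed.

End bernoulli_level.

(** * The counterexample *)

Theorem mainTheorem3 (R : realType) :
  exists (d : measure_display) (X : measurableType d) (T : X -> X)
    (xi : set (set X)) (mu : probability X R) (mu_ : nat -> probability X R)
    (r : nat -> nat) (eps : nat -> R),
    [/\ measurable_automorphism T,
        measurable_partition xi /\ countable xi,
        invariant_measure T mu,
        (forall n, (1 <= n)%N -> invariant_measure T (mu_ n)) &
        (forall n, (1 <= n)%N -> 0 < eps n)] /\
    [/\ r n @[n --> \oo] --> \oo /\ eps n @[n --> \oo] --> 0,
        (forall n, (1 <= n)%N ->
          forall A, dynamical_join T xi (r n).+1 A ->
            (`| mu A - mu_ n A | <= (eps n)%:E * mu_ n A)%E),
        partition_generator T mu xi /\
          (forall n, (1 <= n)%N -> partition_generator T (mu_ n) xi) &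
        (KS_entropy T mu < limn_esup (fun n => KS_entropy T (mu_ n)))%E].
Proof.
(* The measures agree exactly on the atoms of the joins, by [mixture_join], so any positive sequence
   tending to 0 can serve as [eps]. *)
exists _, shift_space, shift, letters, (mixture R pred0),
  (fun n => mixture R (pred1 n)), id, harmonic.
split; split.
- exact: automorphism_shift.
- by split; [exact: measurable_partition_letters|exact: countable_letters].
- exact: invariant_mixture.
- by move=> n _; exact: invariant_mixture.
- by move=> n _; rewrite invr_gt0 ltr0n.
- by split; [exact: cvg_id|exact: cvg_harmonic].
- move=> n _ A JA.
  have mA : measurable A.
    apply: (measurable_dynamical_join automorphism_shift _ JA).
    by have [] := measurable_partition_letters.
  rewrite [X in (X - _)%E](mixture_join R JA) subee ?fin_num_measure// abse0 mule_ge0//.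
  by rewrite lee_fin invr_ge0.
- by split=> [|n _]; exact: generator_letters.
apply: (@le_lt_trans _ _ 0%E).
  apply: ge_ereal_sup => _ [P [mP finP] <-]; rewrite entropy_rate0//.
    exact: automorphism_shift.
  exact: periodic_mixture_almost_finite.
apply: (@lt_le_trans _ _ (ln 2 / 2)%:E).
  by rewrite lte_fin divr_gt0// ln_gt0// ltr1n.
(* The supremum over each tail dominates its first term, whose entropy is at least the rate ln 2 / 2
   of the one-letter word partition. *)
rewrite limn_esup_lim; apply: lime_ge; first exact: is_cvg_esups.
apply: nearW => n.
apply: (@le_trans _ _ (KS_entropy shift (mixture R (pred1 n)))); last first.
  by apply: ereal_sup_ubound; exists n => /=.
rewrite -(entropy_rate_word R n); apply: ereal_sup_ubound.
exists (word_partition n 1) => //.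
by split; [exact: measurable_word_partition|exact: finite_word_partition].
Qed.
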